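(* For every integer $n\ge 1$, the unique coefficient of row $n$ for $l=2$ is $$g_2(n)=n.$$
   Context: For positive integers $l\ge 2$ and $n$, consider the expansion of $(x^{n-1}+x^{n-2}+\cdots+x+1)^l$, whose list of coefficients (of $x^0,x^1,\dots,x^{l(n-1)}$) is called a coefficient pattern. The unique coefficient pattern of row $n$ for the power $l$, denoted $U_n(l)$, consists of the coefficients of this pattern that are not already present in the patterns of the preceding (smaller) $n$. The comparison is made by position from either end of the list: the coefficients of $x^j$ with $j\le n-2$, and symmetrically those with $j\ge (l-1)(n-1)+1$, are the ones already present. So $U_n(l)$ is the ordered list of the coefficients of $x^j$ in $(x^{n-1}+\cdots+1)^l$ for $j=n-1,n,\dots,(l-1)(n-1)$. For $l=2$ this list has exactly one entry, the coefficient of $x^{n-1}$ in $(x^{n-1}+\cdots+1)^2$, denoted $g_2(n)$. Thus $U_1(2)=(1)$, $U_2(2)=(2)$, $U_3(2)=(3)$. *)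

(* Defs.v *)
From mathcomp Require Import all_boot all_order all_algebra.

Set Implicit Arguments.
Unset Strict Implicit.
Unset Printing Implicit Defensive.

Import GRing.Theory.
Local Open Scope ring_scope.

Definition row_poly (n : nat) : {poly int} := \sum_(i < n) 'X^i.

(* Coefficients of x^0, x^1, ..., x^(l(n-1)) in this order; for n >= 1 the
   leading coefficient is 1, so [polyseq] lists exactly all of them. *)
Definition coef_pattern (l n : nat) : seq int := polyseq (row_poly n ^+ l).

(* U_n(l): the entries at positions j <= n-2 and j >= (l-1)(n-1)+1 already
   occur, at the same distance from that end, in the pattern of a smaller n;
   the others have n-1 <= j <= (l-1)(n-1). *)
Definition unique_pattern (l n : nat) : seq int :=
  [seq (coef_pattern l n)`_j | j <- index_iota n.-1 (l.-1 * n.-1).+1].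

Definition g2 (n : nat) : int := (row_poly n ^+ 2)`_n.-1.

(* Main.v *)
Require Import Defs.
From mathcomp Require Import all_boot all_order all_algebra.

Import GRing.Theory.
Local Open Scope ring_scope.

(** The coefficient of x^(n-1) in the square is a convolution over the [n] pairs i + j = n-1; both
    indices stay below [n], where [row_poly n] has coefficient 1, so every term is 1. *)

Lemma coef_row_poly (n i : nat) : (row_poly n)`_i = (i < n)%N%:R.
Proof.
have -> : row_poly n = \poly_(j < n) 1.
  by rewrite poly_def; apply: eq_bigr => j _; rewrite scale1r.
by rewrite coef_poly; case: ifP.
Qed.

Theorem proposition2p1 (n : nat) (hn : (1 <= n)%N) :
  unique_pattern 2 n = [:: g2 n] /\ g2 n = n%:Z.
Proof.
case: n hn => // n _; split.
  (* For l = 2 the range of positions shrinks to the middle index alone. *)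
  by rewrite /unique_pattern /= mul1n /index_iota subSnn.
rewrite /g2 expr2 coefM /=.
rewrite (eq_bigr (fun=> 1)) => [|i _].
  by rewrite sumr_const card_ord natz.
(* Here [n] is the predecessor of the row number: [i] and [n - i] are both at most [n]. *)
by rewrite !coef_row_poly ltn_ord ltnS leq_subr mulr1.
Qed.
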